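(* Let $K$ be a finite simplicial complex. Then $K$ is strong collapsible if and only if its barycentric subdivision $K'$ is strong collapsible.
   Context: All simplicial complexes are finite (simplices are nonempty finite sets of vertices). For a vertex $v$ of a complex $K$, the link $\mathrm{lk}_K(v)$ is the subcomplex of simplices $\tau\in K$ with $v\notin\tau$ and $\tau\cup\{v\}\in K$, and $K\smallsetminus v$ is the full subcomplex of $K$ spanned by the vertices different from $v$. A simplicial cone is a complex $aM$, the join of a (possibly empty) complex $M$ and a vertex $a$ not in $M$; its simplices are $\{a\}$, the simplices $\tau$ of $M$, and the sets $\{a\}\cup\tau$ with $\tau\in M$. A vertex $v$ of $K$ is dominated if $\mathrm{lk}_K(v)$ is a simplicial cone; in that case there is an elementary strong collapse from $K$ to $K\smallsetminus v$. A strong collapse from $K$ to a subcomplex $L$ is a finite (possibly empty) sequence of elementary strong collapses starting in $K$ and ending in $L$. A complex is strong collapsible if it strong collapses to one of its vertices. The barycentric subdivision $K'$ of $K$ has one vertex $\hat\sigma$ for each simplex $\sigma$ of $K$, and its simplices are the sets $\{\hat\sigma_0,\ldots,\hat\sigma_r\}$ corresponding to chains $\sigma_0\subseteq\sigma_1\subseteq\cdots\subseteq\sigma_r$ of simplices of $K$. *)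

(* Defs.v *)
From mathcomp Require Import all_boot.

Set Implicit Arguments.
Unset Strict Implicit.
Unset Printing Implicit Defensive.

(* Vertices live in an ambient finite type T, and a complex is given by its set
   of simplices; an element x of T is a vertex of K only when [set x] \in K. *)

Definition simplicial_complex (T : finType) (K : {set {set T}}) : bool :=
  (set0 \notin K) &&
  [forall s in K, forall t : {set T},
     (t \subset s) ==> (t != set0) ==> (t \in K)].

Definition vertices (T : finType) (K : {set {set T}}) : {set T} :=
  [set v | [set v] \in K].

Definition full_subcomplex (T : finType) (K : {set {set T}}) (A : {set T}) :
    {set {set T}} :=
  [set s in K | s \subset A].

Definition link (T : finType) (K : {set {set T}}) (v : T) : {set {set T}} :=
  [set t in K | (v \notin t) && (v |: t \in K)].

Definition deletion (T : finType) (K : {set {set T}}) (v : T) :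
    {set {set T}} :=
  full_subcomplex K (vertices K :\ v).

Definition cone (T : finType) (a : T) (M : {set {set T}}) : {set {set T}} :=
  [set a] |: (M :|: [set a |: t | t in M]).

Definition simplicial_cone (T : finType) (L : {set {set T}}) : bool :=
  [exists a : T, exists M : {set {set T}},
     [&& simplicial_complex M, a \notin vertices M & L == cone a M]].

Definition dominated (T : finType) (K : {set {set T}}) (v : T) : bool :=
  (v \in vertices K) && simplicial_cone (link K v).

Definition elementary_strong_collapse (T : finType) : rel {set {set T}} :=
  fun K L => [exists v : T, dominated K v && (L == deletion K v)].

Definition strong_collapse (T : finType) : rel {set {set T}} :=
  connect (@elementary_strong_collapse T).

Definition strong_collapsible (T : finType) (K : {set {set T}}) : bool :=
  [exists v in vertices K, strong_collapse K [set [set v]]].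

(* The vertex of the subdivision attached to a simplex s of K is s itself, so
   the subdivision is a complex over the ambient type {set T}. *)
Definition barycentric_subdivision (T : finType) (K : {set {set T}}) :
    {set {set {set T}}} :=
  [set C : {set {set T}} |
     [&& C != set0, C \subset K &
         [forall s in C, forall t in C, (s \subset t) || (t \subset s)]]].

Lemma barycentric_subdivisionP (T : finType) (K C : {set {set T}}) :
  reflect (exists s0 s, [/\ {subset s0 :: s <= K},
             path (fun x y : {set T} => x \subset y) s0 s
           & C = [set x in s0 :: s]])
          (C \in barycentric_subdivision K).
Proof.
pose le := fun x y : {set T} => x \subset y.
have le_tr : transitive le by move=> y x z; apply: subset_trans.
rewrite inE; apply: (iffP and3P) => [[C0 /subsetP CK Ch]|[s0 [s [sK ps ->]]]].
  have tot : {in C &, total le}.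
    by move=> x y xC yC; move/forall_inP/(_ x xC)/forall_inP/(_ y yC): Ch.
  have so : sorted le (sort le (enum C)).
    apply: (@sort_sorted_in _ (mem C)) => //.
    by apply/allP => x; rewrite mem_enum.
  have mm x : (x \in sort le (enum C)) = (x \in C).
    by rewrite mem_sort mem_enum.
  case E : (sort le (enum C)) so mm => [|s0 s] so mm.
    by case/set0Pn: C0 => x; rewrite -mm.
  exists s0, s; split=> // [x|]; first by rewrite mm => /CK.
  by apply/setP => x; rewrite inE mm.
split.
- by apply/set0Pn; exists s0; rewrite inE mem_head.
- by apply/subsetP => x; rewrite inE => /sK.
apply/forall_inP => x; rewrite inE => xs; apply/forall_inP => y.
rewrite inE => ys; have so : sorted le (s0 :: s) by [].
have [|/ltnW] := leqP (index x (s0 :: s)) (index y (s0 :: s)) => lij.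
  by apply/orP; left; apply: (sorted_leq_index le_tr _ so) => // z; exact: subxx.
by apply/orP; right; apply: (sorted_leq_index le_tr _ so) => // z; exact: subxx.
Qed.

Lemma simplicial_complexP (T : finType) (K : {set {set T}}) :
  reflect (set0 \notin K /\
           forall s t : {set T}, s \in K -> t \subset s -> t != set0 -> t \in K)
          (simplicial_complex K).
Proof.
apply: (iffP andP) => -[K0 H]; split=> //.
  move=> s t sK ts t0.
  by move/forall_inP/(_ s sK)/forallP/(_ t)/implyP/(_ ts)/implyP: H; apply.
apply/forall_inP => s sK; apply/forallP => t.
by apply/implyP => ts; apply/implyP => t0; apply: (H s).
Qed.

Lemma simplicial_complex_link (T : finType) (K : {set {set T}}) (v : T) :
  simplicial_complex K -> simplicial_complex (link K v).
Proof.
move=> /simplicial_complexP[K0 H]; apply/simplicial_complexP; split.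
  by rewrite inE (negPf K0).
move=> s t; rewrite !inE => /and3P[sK vs vsK] ts t0; apply/and3P; split.
- exact: H sK ts t0.
- by apply: contra vs; apply: (subsetP ts).
- apply: H vsK _ _; first exact: setUS.
  by apply/set0Pn; exists v; rewrite setU11.
Qed.

Lemma simplicial_complex_deletion (T : finType) (K : {set {set T}}) (v : T) :
  simplicial_complex K -> simplicial_complex (deletion K v).
Proof.
move=> /simplicial_complexP[K0 H]; apply/simplicial_complexP; split.
  by rewrite inE (negPf K0).
move=> s t; rewrite !inE => /andP[sK sv] ts t0.
by rewrite (H s t) ?(subset_trans ts sv).
Qed.

Lemma simplicial_complex_barycentric (T : finType) (K : {set {set T}}) :
  simplicial_complex (barycentric_subdivision K).
Proof.
apply/simplicial_complexP; split; first by rewrite inE eqxx.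
move=> C D; rewrite !inE => /and3P[C0 CK Ch] DC D0; apply/and3P; split=> //.
  exact: subset_trans DC CK.
apply/forall_inP => s sD; apply/forall_inP => t tD.
move/forall_inP/(_ s (subsetP DC s sD))/forall_inP: Ch.
by apply; apply: (subsetP DC).
Qed.

(* Main.v *)
(** Both directions rest on the following description of domination: [v] is
    dominated when some [a != v] can be added to every simplex containing [v].

    Left to right, removing [v] from [K] is simulated in the subdivision by
    removing first the barycenters of the simplices with [v] and without [a],
    larger ones first ([s] being dominated by [a |: s]), then those of the
    simplices with both, smaller ones first ([s] being dominated by [s :\ v]).

    Right to left, let [r] retract [K] onto a complex [L] without dominated
    vertices, obtained by strong collapses.  A strong collapse of [K'] to a vertex
    connects the identity of [K'] to a constant map through contiguous maps [f].
    Every such [f] satisfies [r (f s) = s] when [s] is a vertex or a maximal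
    simplex of [L]: a simplex comparable with the vertices of a maximal simplex
    is that simplex, and one comparable with a vertex [x] and with all the maximal
    simplices around [x] is [x] itself, since [x] is not dominated.  As the last
    map is constant, [L] has a single vertex. *)
Require Import Defs.
From mathcomp Require Import all_boot.

(** * Deletion and domination expressed through simplices *)

Lemma connect_ind (V : finType) (e : rel V) (x : V) (P : V -> Prop) :
  P x -> (forall u w, P u -> e u w -> P w) -> forall y, connect e x y -> P y.
Proof.
move=> Px eP y /connectP[p + ->]; elim: p x Px => //= z p IHp x Px /andP[exz].
by apply: IHp; apply: eP Px exz.
Qed.

Lemma in_deletion (T : finType) (K : {set {set T}}) (v : T) (s : {set T}) :
  simplicial_complex K -> (s \in deletion K v) = (s \in K) && (v \notin s).
Proof.
move=> /simplicial_complexP[_ KS]; rewrite inE; apply: andb_id2l => sK.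
apply/subsetP/idP => [sub|vs x xs].
  by apply/negP => /sub; rewrite !inE eqxx.
rewrite !inE; apply/andP; split; first by apply: contraNneq vs => <-.
by apply: KS sK _ _; [rewrite sub1set | apply/set0Pn; exists x; rewrite inE].
Qed.

Lemma dominatedP (T : finType) (K : {set {set T}}) (v : T) :
  simplicial_complex K ->
  reflect ([set v] \in K /\ exists2 a, a != v &
             forall s : {set T}, s \in K -> v \in s -> a |: s \in K)
          (dominated K v).
Proof.
move=> Kc; have /simplicial_complexP[K0 KS] := Kc.
have nz (x : T) (s : {set T}) : x |: s != set0.
  by apply/set0Pn; exists x; rewrite setU11.
rewrite /dominated inE; apply: (iffP andP) => -[vK].
  case/existsP=> a /existsP[M /and3P[Mc _ /eqP lkE]]; split=> //.
  have : [set a] \in link K v by rewrite lkE !inE eqxx.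
  rewrite !inE => /and3P[aK va vaK]; exists a; first by rewrite eq_sym.
  (* The case [s = [set v]] is separate: [s :\ v] is then empty, hence not a simplex of the link. *)
  move=> s sK vs; have [s0|s_n0] := eqVneq (s :\ v) set0.
    suff -> : s = [set v] by rewrite setUC.
    by apply/eqP; rewrite eqEsubset sub1set vs -setD_eq0 s0 eqxx.
  have : s :\ v \in link K v.
    by rewrite !inE eqxx setD1K // sK (KS s) // subD1set.
  suff lkU t : t \in link K v -> a |: t \in link K v.
    by move=> /lkU; rewrite inE setUCA setD1K // => /and3P[].
  rewrite lkE; case/setU1P=> [->|]; first by rewrite setUid setU11.
  case/setUP=> [tM|/imsetP[t' t'M ->]].
    by apply/setU1P; right; apply/setUP; right; apply: imset_f.
  rewrite setUA setUid.
  by apply/setU1P; right; apply/setUP; right; apply: imset_f.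
case=> a av aU; split=> //; apply/existsP; exists a.
have lkc := simplicial_complex_link v Kc.
have /simplicial_complexP[lk0 lkS] := lkc.
have va : [set v; a] \in K by rewrite setUC aU // inE.
have alk : [set a] \in link K v.
  rewrite !inE eq_sym av va !andbT; apply: KS va _ _; first exact: subsetUr.
  by apply/set0Pn; exists a; rewrite inE.
have lkU t : t \in link K v -> a |: t \in link K v.
  rewrite !inE => /and3P[tK vt vtK]; rewrite eq_sym (negPf av) vt /=.
  have avt : v |: (a |: t) \in K by rewrite setUCA aU // setU11.
  by rewrite avt andbT; apply: KS avt _ _; rewrite ?subsetUr.
(* The apex is [a] and the base consists of the simplices of the link that avoid [a]. *)
apply/existsP; exists [set t in link K v | a \notin t]; apply/and3P; split.
- apply/simplicial_complexP; split; first by rewrite inE (negPf lk0).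
  move=> s t; rewrite inE => /andP[sl as_] ts t0; rewrite inE (lkS s) //=.
  by apply: contra as_; apply: (subsetP ts).
- by rewrite inE inE set11 andbF.
apply/eqP/setP => t; apply/idP/idP => [tl|].
  have [at_|nat_] := boolP (a \in t); last first.
    by apply/setU1P; right; apply/setUP; left; rewrite inE tl.
  have [t0|t_n0] := eqVneq (t :\ a) set0.
    suff -> : t = [set a] by rewrite setU11.
    by apply/eqP; rewrite eqEsubset sub1set at_ -setD_eq0 t0 eqxx.
  apply/setU1P; right; apply/setUP; right; apply/imsetP.
  exists (t :\ a); last by rewrite setD1K.
  by rewrite inE (lkS t) ?subD1set //= !inE eqxx.
case/setU1P=> [->//|/setUP[]]; first by rewrite inE => /andP[].
by case/imsetP=> u; rewrite inE => /andP[ul _] ->; apply: lkU.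
Qed.

(** * Strong collapses of the subdivision *)

Lemma set2_in_barycentric (T : finType) (P : {set {set T}}) (s t : {set T}) :
  ([set s; t] \in barycentric_subdivision P) =
  [&& s \in P, t \in P & (s \subset t) || (t \subset s)].
Proof.
rewrite inE subUset !sub1set -andbA.
have -> /= : [set s; t] != set0 by apply/set0Pn; exists s; rewrite set21.
congr [&& _, _ & _]; apply/forall_inP/idP => [/(_ s (set21 _ _))|st u].
  by move/forall_inP/(_ t (set22 _ _)).
case/set2P=> ->; apply/forall_inP => w /set2P[] ->; rewrite ?subxx //.
by rewrite orbC.
Qed.

Lemma set1_in_barycentric (T : finType) (P : {set {set T}}) (s : {set T}) :
  ([set s] \in barycentric_subdivision P) = (s \in P).
Proof. by rewrite -[[set s]]setUid set2_in_barycentric subxx andbT andbb. Qed.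

Lemma barycentric_comparable (T : finType) (P : {set {set T}})
    (C : {set {set T}}) (s t : {set T}) :
  C \in barycentric_subdivision P -> s \in C -> t \in C ->
  (s \subset t) || (t \subset s).
Proof.
by rewrite inE => /and3P[_ _ /forall_inP H] /H/forall_inP; apply.
Qed.

Lemma barycentric_set1 (T : finType) (s : {set T}) :
  barycentric_subdivision [set s] = [set [set s]].
Proof.
apply/setP => C; rewrite [RHS]inE; apply/idP/eqP => [|->].
  rewrite inE subset1 => /and3P[C0 /orP[/eqP//|CE]].
  by rewrite (eqP CE) eqxx in C0.
by rewrite set1_in_barycentric inE.
Qed.

(** A chain through [s] stays a chain when [b] is added, so [b] dominates [s]. The family [P] is
    arbitrary because the intermediate stages of the collapse need not be subdivisions of
    complexes. *)
Lemma barycentric_elementary_collapse (T : finType) (P : {set {set T}})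
    (s b : {set T}) :
  s \in P -> b \in P -> b != s ->
  (forall t : {set T}, t \in P -> (s \subset t) || (t \subset s) ->
     (b \subset t) || (t \subset b)) ->
  elementary_strong_collapse (barycentric_subdivision P)
    (barycentric_subdivision (P :\ s)).
Proof.
move=> sP bP bs H.
have Pc := simplicial_complex_barycentric P.
apply/existsP; exists s; apply/andP; split.
  apply/(dominatedP _ _ s Pc); split; first by rewrite set1_in_barycentric.
  exists b => // C CP sC; have cC := @barycentric_comparable _ _ _ _ _ CP.
  have cb t : t \in C -> (b \subset t) || (t \subset b).
    move=> tC; apply: H; last exact: cC.
    by move: CP; rewrite inE => /and3P[_ /subsetP/(_ t tC)].
  rewrite inE subUset sub1set bP /=; apply/and3P; split.
  - by apply/set0Pn; exists b; rewrite setU11.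
  - by move: CP; rewrite inE => /and3P[].
  apply/forall_inP => x /setU1P[->|xC]; apply/forall_inP => y /setU1P[->|yC].
  - by rewrite subxx.
  - exact: cb.
  - by rewrite orbC cb.
  - exact: cC.
apply/eqP/setP => C; rewrite in_deletion // !inE subsetD1.
by case: (s \in C); rewrite ?andbF ?andbT.
Qed.

(* The elements of [U] are removed in decreasing order of [m], each [s] being
   dominated by [d s] at the moment it is removed. *)
Lemma barycentric_collapse (T : finType) (P U : {set {set T}})
    (m : {set T} -> nat) (d : {set T} -> {set T}) :
  U \subset P -> (forall s, s \in U -> d s \in P :\: U) ->
  (forall s t : {set T}, s \in U -> t \in P ->
     (s \subset t) || (t \subset s) ->
     (d s \subset t) || (t \subset d s) || (t \in U) && (m s < m t)) ->
  strong_collapse (barycentric_subdivision P)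
    (barycentric_subdivision (P :\: U)).
Proof.
have [n] := ubnP #|U|; elim: n P U => // n IHn P U leUn UP dP H.
have [->|[s0 s0U]] := set_0Vmem U; first by rewrite setD0; apply: connect0.
case: (arg_maxnP m s0U) => s sU smax.
have sP := subsetP UP s sU; have := dP s sU; rewrite inE => /andP[dU dPs].
apply: (@connect_trans _ _ (barycentric_subdivision (P :\ s))).
  apply/connect1/(@barycentric_elementary_collapse _ _ _ (d s)) => //.
    by apply: contraNneq dU => ->.
  move=> t tP st; have := H s t sU tP st.
  (* Maximality of [m s] rules out the alternative [m s < m t]. *)
  have [/smax /= le_ts|_] := boolP (t \in U); last by rewrite orbF.
  by rewrite ltnNge (le_ts : m t <= m s) orbF.
have -> : P :\: U = (P :\ s) :\: (U :\ s).
  apply/setP => x; rewrite !inE; case: eqVneq => //= ->.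
  by rewrite (sU : s \in U).
apply: IHn.
- by rewrite (cardsD1 s U) (sU : s \in U) in leUn.
- exact: setSD.
- move=> x /setD1P[_ /dP]; rewrite !inE => /andP[dxU dxP].
  rewrite (negPf dxU) dxP !andbF /= andbT.
  by apply: contraNneq dxU => ->.
move=> x t /setD1P[_ xU] /setD1P[ts tP] xt.
by have := H x t xU tP xt; rewrite !inE ts.
Qed.

Lemma barycentric_collapse_deletion (T : finType) (K : {set {set T}}) (v : T) :
  simplicial_complex K -> dominated K v ->
  strong_collapse (barycentric_subdivision K)
    (barycentric_subdivision (deletion K v)).
Proof.
move=> Kc /(dominatedP _ _ _ Kc)[vK [a av aU]].
have /simplicial_complexP[K0 KS] := Kc.
pose U1 := [set s in K | (v \in s) && (a \notin s)].
pose U2 := [set s in K | (v \in s) && (a \in s)].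
apply: (@connect_trans _ _ (barycentric_subdivision (K :\: U1))).
  apply: (@barycentric_collapse _ _ _ (fun s => #|s|) (fun s => a |: s)).
  - by apply/subsetP => s; rewrite inE => /andP[].
  - move=> s; rewrite inE => /and3P[sK vs _].
    by rewrite !inE eqxx /= !andbF aU.
  move=> s t; rewrite !inE => /and3P[sK vs nas] tK /orP[st|ts]; last first.
    by rewrite (subset_trans ts (subsetUr _ _)) orbT.
  (* Only a [t] strictly containing [s] and avoiding [a] can be incomparable with [a |: s]; it lies
     in [U1] and is larger than [s]. *)
  have [at_|nat_] := boolP (a \in t); first by rewrite subUset sub1set at_ st.
  have [ts|nts] := boolP (t \subset s).
    by rewrite (subset_trans ts (subsetUr _ _)) orbT.
  by rewrite tK (subsetP st) //= [in X in _ || X]proper_card ?orbT // properE st.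
have -> : deletion K v = (K :\: U1) :\: U2.
  apply/setP => s; rewrite in_deletion // !inE.
  by case: (s \in K); case: (v \in s); case: (a \in s).
(* Measuring complements puts the smaller simplices first. A [t] incomparable with [s :\ v] contains
   [v], hence also [a] since [U1] is gone, and is strictly smaller than [s]. *)
apply: (@barycentric_collapse _ _ _ (fun s => #|~: s|) (fun s => s :\ v)).
- apply/subsetP => s; rewrite !inE => /and3P[-> -> ->] //.
- move=> s; rewrite inE => /and3P[sK vs as_].
  rewrite !inE eqxx /= !andbF /=; apply: KS sK (subD1set _ _) _.
  by apply/set0Pn; exists a; rewrite !inE av.
move=> s t; rewrite !inE => /and3P[sK vs as_] /andP[nt tK] /orP[st|ts].
  by rewrite (subset_trans (subD1set _ _) st).
have [vt|nvt] := boolP (v \in t); last by rewrite subsetD1 ts nvt orbT.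
move: nt; rewrite tK vt /= negbK => at_.
have [st|nst] := boolP (s \subset t).
  by rewrite (subset_trans (subD1set _ _) st).
by rewrite at_ [in X in _ || X]proper_card ?orbT // properC properE ts.
Qed.

Lemma barycentric_strong_collapse (T : finType) (K L : {set {set T}}) :
  simplicial_complex K -> strong_collapse K L ->
  strong_collapse (barycentric_subdivision K) (barycentric_subdivision L).
Proof.
move=> Kc KL.
suff [] : simplicial_complex L /\
    strong_collapse (barycentric_subdivision K) (barycentric_subdivision L) by [].
move: L KL; apply: connect_ind => [|X Y [Xc KX]]; first by split=> //; apply: connect0.
case/existsP=> v /andP[vX /eqP->]; split; first exact: simplicial_complex_deletion.
exact: connect_trans KX (barycentric_collapse_deletion _ _ _ Xc vX).
Qed.

(** * Retractions and cores *)

(* [contiguous K f g] entails that [f] and [g] are simplicial maps when [K] is a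
   complex. *)
Definition contiguous {T : finType} (K : {set {set T}}) : rel {ffun T -> T} :=
  fun f g => [forall s in K, f @: s :|: g @: s \in K].

(** An elementary collapse is realized by the map [p] sending [v] to a dominating [a]. As
    [s :|: p @: s] is [s] or [a |: s], composing with [p] gives a map contiguous to the previous
    one. *)
Lemma strong_collapse_retraction (T : finType) (K L : {set {set T}}) :
  simplicial_complex K -> strong_collapse K L ->
  [/\ simplicial_complex L, L \subset K & exists r : {ffun T -> T},
    [/\ forall s, s \in K -> r @: s \in L, forall s, s \in L -> r @: s = s
      & connect (contiguous K) [ffun x => x] r]].
Proof.
move=> Kc; move: L; apply: connect_ind => [|X Y [Xc XK [r [rX rid cr]]]].
  have id_im (s : {set T}) : [ffun x : T => x] @: s = s.
    by rewrite -[RHS]imset_id; apply: eq_imset => x; rewrite ffunE.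
  by split=> //; exists [ffun x => x]; split=> // s; rewrite id_im.
case/existsP=> v /andP[/(dominatedP _ _ _ Xc)[vX [a av aU]] /eqP->].
have /simplicial_complexP[X0 XS] := Xc.
split; first exact: simplicial_complex_deletion.
  by apply: subset_trans XK; apply/subsetP => s; rewrite in_deletion // => /andP[].
pose p x := if x == v then a else x.
have p_im (s : {set T}) : v \notin s -> p @: s = s.
  move=> vs; rewrite -[RHS]imset_id; apply: eq_in_imset => x xs; rewrite /p.
  by case: eqVneq => // xv; rewrite -xv xs in vs.
have pU (s : {set T}) : s \in X -> s :|: p @: s \in X.
  move=> sX; have [vs|vs] := boolP (v \in s); last by rewrite p_im // setUid.
  rewrite (_ : _ :|: _ = a |: s) ?aU //; apply/setP => x; rewrite !inE.
  apply/orP/orP => [[->|/imsetP[y ys ->]]|[/eqP->|->]]; try by [right | left].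
    by rewrite /p; case: (eqVneq y v) => _; [left | right].
  by right; apply/imsetP; exists v; rewrite // /p eqxx.
exists [ffun x => p (r x)].
have pr_im (s : {set T}) : [ffun x => p (r x)] @: s = p @: (r @: s).
  by rewrite -imset_comp; apply: eq_imset => x; rewrite ffunE.
split=> [s sK|s|].
- rewrite pr_im in_deletion //; apply/andP; split.
    apply: XS (pU _ (rX _ sK)) (subsetUr _ _) _; rewrite imset_eq0.
    by apply: contraNneq X0 => <-; apply: rX.
  apply/imsetP => -[y _ /eqP]; rewrite /p.
  by case: (eqVneq y v) => [_|yv]; rewrite eq_sym ?(negPf av) ?(negPf yv).
- by rewrite pr_im in_deletion // => /andP[sX vs]; rewrite rid // p_im.
apply: connect_trans cr (connect1 _); apply/forall_inP => s sK.
by rewrite pr_im; apply: (subsetP XK); apply/pU/rX.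
Qed.

Lemma strong_collapse_core (T : finType) (K : {set {set T}}) :
  simplicial_complex K ->
  exists2 L, strong_collapse K L & forall v, ~~ dominated L v.
Proof.
have [n] := ubnP #|K|; elim: n K => // n IHn K ltKn Kc.
have [/existsP[v vK]|/existsPn ndom] := boolP [exists v, dominated K v]; last first.
  by exists K => //; apply: connect0.
have [] := IHn (deletion K v); last 1 first.
- move=> L KL ndom; exists L => //; apply: connect_trans KL; apply: connect1.
  by apply/existsP; exists v; rewrite vK eqxx.
(* The simplex [[set v]] is lost, so the number of simplices decreases. *)
- apply: (leq_trans _ (ltKn : #|K| <= n)); apply: proper_card; apply/properP; split.
    by apply/subsetP => s; rewrite in_deletion // => /andP[].
  have /(dominatedP _ _ _ Kc)[vK' _] := vK.
  by exists [set v]; rewrite // in_deletion // set11 andbF.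
- exact: simplicial_complex_deletion.
Qed.

Lemma comparable_set1 (T : finType) (x : T) (s : {set T}) :
  s != set0 -> ([set x] \subset s) || (s \subset [set x]) -> x \in s.
Proof.
move=> s0 /orP[|]; first by rewrite sub1set.
by rewrite subset1 (negPf s0) orbF => /eqP->; rewrite inE.
Qed.

Theorem theorem4p15 (T : finType) (K : {set {set T}})
    (hK : simplicial_complex K) :
  strong_collapsible K <-> strong_collapsible (barycentric_subdivision K).
Proof.
split=> [/exists_inP[v]|/exists_inP[w]].
  rewrite inE => vK Kv; apply/exists_inP; exists [set v].
    by rewrite inE set1_in_barycentric.
  by rewrite -barycentric_set1; apply: barycentric_strong_collapse.
rewrite inE set1_in_barycentric => wK Kw.
have [L KL ndom] := strong_collapse_core _ _ hK.
have [Lc LK [r [rL rid _]]] := strong_collapse_retraction _ _ _ hK KL.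
have /simplicial_complexP[L0 LS] := Lc.
have [_ _ [c [cw _ idc]]] :=
  strong_collapse_retraction _ _ _ (simplicial_complex_barycentric K) Kw.
have n0 (s : {set T}) : s \in L -> s != set0.
  by move=> sL; apply: contraNneq L0 => <-.
have inL s x : s \in L -> x \in s -> [set x] \in L.
  move=> sL xs; apply: LS sL _ _; first by rewrite sub1set.
  by apply/set0Pn; exists x; rewrite inE.
pose mx s := maxset (fun t => t \in L) s.
have [rmx rv] : (forall s, mx s -> r @: c s = s) /\
    (forall x, [set x] \in L -> r @: c [set x] = [set x]).
  move: c idc {cw}; apply: connect_ind => [|f g [fmx fv] /forall_inP fg].
    by split=> [s /maxsetp|x] sL; rewrite ffunE rid.
  (* The images of [s] and [t] under [f] and [g] lie in one simplex of the subdivision, hence form a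
     chain, and taking images under [r] preserves inclusions. *)
  have comp s t : s \in L -> t \in L -> s \subset t ->
      [/\ r @: g s \in L, r @: g t \in L,
          (r @: f s \subset r @: g t) || (r @: g t \subset r @: f s),
          (r @: f s \subset r @: g s) || (r @: g s \subset r @: f s) &
          (r @: f t \subset r @: g s) || (r @: g s \subset r @: f t)].
    move=> sL tL st.
    have /fg C : [set s; t] \in barycentric_subdivision K.
      by rewrite set2_in_barycentric !(subsetP LK) ?st.
    have rC := @barycentric_comparable _ _ _ _ _ C.
    have inK u : u \in f @: [set s; t] :|: g @: [set s; t] -> r @: u \in L.
      by move: C; rewrite inE => /and3P[_ /subsetP CK _] /CK/rL.
    have incl u u' : u \in f @: [set s; t] :|: g @: [set s; t] ->
        u' \in f @: [set s; t] :|: g @: [set s; t] ->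
        (r @: u \subset r @: u') || (r @: u' \subset r @: u).
      by move=> uC u'C; case/orP: (rC u u' uC u'C) => /(imsetS r) ->; rewrite ?orbT.
    by split; [apply: inK | apply: inK | apply: incl ..];
       rewrite !imsetU1 !imset_set1 !inE eqxx ?orbT.
  split=> [s /[dup] smx /maxsetP[sL smax]|x xL].
    have gsL : r @: g s \in L by have [] := comp s s sL sL (subxx _).
    (* Each vertex [x] of [s] lies in [r @: g s], which is comparable with [r @: f [set x] =
       [set x]]; maximality of [s] then gives equality. *)
    apply: smax => //; apply/subsetP => x xs.
    apply: comparable_set1 (n0 _ gsL) _.
    have xL := inL s x sL xs; rewrite -{1 2}(fv x xL).
    by have [] := comp [set x] s xL sL; rewrite ?sub1set.
  have [gxL _ _ cx _] := comp _ _ xL xL (subxx _).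
  rewrite fv // in cx; have xg := comparable_set1 _ _ _ (n0 _ gxL) cx.
  apply/eqP; rewrite eqEsubset sub1set xg andbT; apply/subsetP => y yg.
  (* A second element [y] of [r @: g [set x]] would dominate [x]: any simplex [s] around [x] lies in
     a maximal [t], and [r @: g [set x]], being comparable with [r @: f t = t], is contained in
     [t]. *)
  rewrite inE; apply: contraNT (ndom x) => yx.
  apply/dominatedP => //; split=> //; exists y => // s sL xs.
  have [t tmx st] := maxset_exists (P := fun t => t \in L) sL.
  have [tL tmax] := maxsetP tmx.
  apply: (LS t) => //; last by apply/set0Pn; exists y; rewrite setU11.
  rewrite subUset st andbT sub1set.
  have [_ _ _ _] := comp _ _ xL tL (subset_trans (etrans (sub1set _ _) xs) st).
  by rewrite fmx // => /orP[/(tmax _ gxL) <-|/subsetP->].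
(* The map [c] takes the value [w] at each [[set x]], so all vertices of [L] give the same set
   [r @: w]. *)
have {}rv x : [set x] \in L -> r @: w = [set x].
  move=> xL; rewrite -(rv x xL); congr (_ @: _).
  have : c @: [set [set x]] \in [set [set w]].
    by apply: cw; rewrite set1_in_barycentric (subsetP LK).
  by rewrite imset_set1 => /set1P/set1_inj->.
have wL := rL w wK; have /set0Pn[x xw] : r @: w != set0 := n0 _ wL.
have xL := inL _ _ wL xw.
apply/exists_inP; exists x; first by rewrite inE (subsetP LK).
suff <- : L = [set [set x]] by [].
apply/setP => s; rewrite [RHS]inE; apply/idP/eqP => [sL|->//].
have sx : s \subset [set x].
  apply/subsetP => y ys; rewrite -(rv x xL) (rv y) ?inE //.
  exact: inL sL ys.
by move: sx; rewrite subset1 => /orP[/eqP//|/eqP s0]; rewrite s0 (negPf L0) in sL.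
Qed.
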